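(* (Blinkered unitary.) Let $m,n\ge1$, let $x_{g_1},\dots,x_{g_m}\ge0$ be not all zero, let $x_{h_1},\dots,x_{h_n}>0$, and let $p_{g_1},\dots,p_{g_m},p_{h_1},\dots,p_{h_n}>0$ with $\sum_ip_{g_i}=\sum_ip_{h_i}$. Let $|g_1\rangle,\dots,|g_m\rangle,|h_1\rangle,\dots,|h_n\rangle$ be orthonormal, let $|v\rangle=\sum_i\sqrt{p_{g_i}}|g_i\rangle/\sqrt{\sum_ip_{g_i}}$ and $|w\rangle=\sum_i\sqrt{p_{h_i}}|h_i\rangle/\sqrt{\sum_ip_{h_i}}$, complete these to orthonormal bases $|v\rangle,\{|v_i\rangle\}$ of $\mathrm{span}\{|g_i\rangle\}$ and $|w\rangle,\{|w_i\rangle\}$ of $\mathrm{span}\{|h_i\rangle\}$, and let $$U=|w\rangle\langle v|+|v\rangle\langle w|+\sum_i|v_i\rangle\langle v_i|+\sum_i|w_i\rangle\langle w_i|,\qquad E_h=\sum_i|h_i\rangle\langle h_i|.$$ Then the constraint $$\sum_{i=1}^nx_{h_i}|h_i\rangle\langle h_i|-\sum_{i=1}^mx_{g_i}E_hU|g_i\rangle\langle g_i|U^\dagger E_h\ge0$$ holds if and only if $$\frac1{\langle x_g\rangle}\ge\left\langle\frac1{x_h}\right\rangle .$$ In particular the blinkered unitary $U$ satisfies the constraint for every merge ($n=1$, $x_{h_1}\ge\langle x_g\rangle$ with not all $x_{g_i}$ zero) and every split ($m=1$, $\frac1{x_{g_1}}\ge\langle\frac1{x_h}\rangle$).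
   Context: Averages are weighted: $\langle x_g\rangle=\frac{\sum_ip_{g_i}x_{g_i}}{\sum_ip_{g_i}}$ and $\left\langle\frac1{x_h}\right\rangle=\frac{\sum_ip_{h_i}/x_{h_i}}{\sum_ip_{h_i}}$. Matrix inequalities are in the positive semidefinite order. *)

(* Defs.v *)
From HB Require Import structures.
From mathcomp Require Import all_boot all_order all_algebra.
From mathcomp Require Import sesquilinear spectral complex.

Set Implicit Arguments.
Unset Strict Implicit.
Unset Printing Implicit Defensive.

Import Order.TTheory GRing.Theory Num.Theory.
Local Open Scope ring_scope.
Local Open Scope complex_scope.
Local Open Scope sesquilinear_scope.

Definition wavg (R : rcfType) (k : nat) (p x : 'I_k -> R) : R :=
  (\sum_i p i * x i) / (\sum_i p i).

(* Kets are column vectors over R[i], bras their conjugate transposes;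
   [ketbra u v] is |u><v|. *)
Definition ketbra (R : rcfType) (d : nat) (u v : 'cV[R[i]]_d) : 'M[R[i]]_d :=
  u *m v^t*.

(* [dotmx] is the standard Hermitian inner product of row vectors, hence the
   transpositions. *)
Definition orthonormal_kets (R : rcfType) (d : nat) (s : seq 'cV[R[i]]_d) :
    bool :=
  orthonormal (@dotmx R[i] d) [seq u^T | u <- s].

Definition orthonormal_basis_of (R : rcfType) (d : nat)
    (V : {vspace 'cV[R[i]]_d}) (s : seq 'cV[R[i]]_d) : bool :=
  orthonormal_kets s && basis_of V s.

(* sum_i sqrt(p_i) |f_i> / sqrt(sum_i p_i) *)
Definition weighted_ket (R : rcfType) (d k : nat) (p : 'I_k -> R)
    (f : 'I_k -> 'cV[R[i]]_d) : 'cV[R[i]]_d :=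
  ((Num.sqrt (\sum_i p i))^-1)%:C *: \sum_i (Num.sqrt (p i))%:C *: f i.

Definition blinkered (R : rcfType) (d : nat) (v w : 'cV[R[i]]_d)
    (vs ws : seq 'cV[R[i]]_d) : 'M[R[i]]_d :=
  ketbra w v + ketbra v w
  + \sum_(u <- vs) ketbra u u + \sum_(u <- ws) ketbra u u.

(* The order on R[i] makes [0 <= z] mean that z is real and nonnegative. *)
Definition psdmx (R : rcfType) (d : nat) (A : 'M[R[i]]_d) : Prop :=
  A^t* = A /\ forall u : 'cV[R[i]]_d, 0 <= (u^t* *m A *m u) 0 0.

(* Main.v *)
Require Import Defs.
From mathcomp Require Import all_boot all_order all_algebra.
From mathcomp Require Import sesquilinear spectral complex.

Set Implicit Arguments.
Unset Strict Implicit.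
Unset Printing Implicit Defensive.

Import Order.TTheory GRing.Theory Num.Theory.
Local Open Scope ring_scope.
Local Open Scope complex_scope.
Local Open Scope sesquilinear_scope.

(** Since [E_h] kills the span of the [g_i] and fixes the span of the [h_j], the
    only part of [U] that survives in [E_h U |g_i>] is [|w><v|], so the
    constraint reads [X_h - <x_g> |w><w| >= 0] with [X_h] the diagonal operator
    of the [x_h].  By Cauchy-Schwarz this rank-one update is positive
    semidefinite iff [<x_g> <w|X_h^-1|w> <= 1], the extremal ket being
    [X_h^-1 |w>], and [<w|X_h^-1|w>] is the average [<1/x_h>].  Merges and
    splits are the cases in which one of the two averages is over a single point. *)

(** * Inner product of kets *)

Definition braket (C : numClosedFieldType) (d : nat) (u v : 'cV[C]_d) : C :=
  (u^t* *m v) 0 0.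

Section Braket.

Variables (C : numClosedFieldType) (d : nat).
Implicit Types (u v w : 'cV[C]_d) (a : C).

Lemma braketE u v : braket u v = \sum_k (u k 0)^*%R * v k 0.
Proof. by rewrite /braket mxE; apply: eq_bigr => k _; rewrite !mxE. Qed.

Lemma braket_mx u v : u^t* *m v = (braket u v)%:M.
Proof. exact: mx11_scalar. Qed.

(** [dotmx] is conjugate-linear in its second argument while a bra-ket is so in its first, hence the
    exchanged arguments. *)
Lemma braket_dotmx u v : braket u v = dotmx v^T u^T.
Proof.
rewrite dotmxE braketE mxE; apply: eq_bigr => k _.
by rewrite !mxE mulrC.
Qed.

Lemma braketC u v : braket v u = (braket u v)^*%R.
Proof.
rewrite !braketE rmorph_sum; apply: eq_bigr => k _.
by rewrite rmorphM /= conjCK mulrC.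
Qed.

Lemma braketZr u v a : braket u (a *: v) = a * braket u v.
Proof. by rewrite /braket -scalemxAr mxE. Qed.

Lemma braketZl u v a : braket (a *: u) v = a^*%R * braket u v.
Proof. by rewrite braketC braketZr rmorphM /= -braketC. Qed.

Lemma braket_sumr I (r : seq I) (F : I -> 'cV[C]_d) u :
  braket u (\sum_(i <- r) F i) = \sum_(i <- r) braket u (F i).
Proof. by rewrite /braket mulmx_sumr summxE. Qed.

Lemma braket_suml I (r : seq I) (F : I -> 'cV[C]_d) u :
  braket (\sum_(i <- r) F i) u = \sum_(i <- r) braket (F i) u.
Proof.
rewrite braketC braket_sumr rmorph_sum; apply: eq_bigr => i _.
by rewrite /= -braketC.
Qed.

Lemma braket_span u v (X : seq 'cV[C]_d) :
  {in X, forall x, braket u x = 0} -> v \in <<X>>%VS -> braket u v = 0.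
Proof.
move=> X0 /(@coord_span _ _ _ (in_tuple X)) ->.
rewrite braket_sumr big1 // => i _.
by rewrite braketZr X0 ?mulr0 // mem_nth.
Qed.

End Braket.

(** * Adjoints, rank-one operators and weighted kets *)

Section Ketbra.

Variables (R : rcfType) (d : nat).
Implicit Types (u v w : 'cV[R[i]]_d) (c : R).

Lemma conj_realC c : (c%:C : R[i])^*%R = c%:C.
Proof. by apply: conj_Creal; apply/complex_realP; exists c. Qed.

Lemma adj_mxM k l m (A : 'M[R[i]]_(k, l)) (B : 'M_(l, m)) :
  (A *m B)^t* = B^t* *m A^t*.
Proof. by rewrite trmx_mul map_mxM. Qed.

Lemma adj_mxK k l (A : 'M[R[i]]_(k, l)) : A^t*^t* = A.
Proof. by apply/matrixP => a b; rewrite !mxE conjCK. Qed.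

Lemma adj_ketbra u v : (ketbra u v)^t* = ketbra v u.
Proof. by rewrite /ketbra adj_mxM adj_mxK. Qed.

Lemma adj_sum_ketbra I (r : seq I) (c : I -> R) (f : I -> 'cV[R[i]]_d) :
  (\sum_(i <- r) (c i)%:C *: ketbra (f i) (f i))^t* =
  \sum_(i <- r) (c i)%:C *: ketbra (f i) (f i).
Proof.
rewrite linear_sum /= map_mx_sum; apply: eq_bigr => i _.
by rewrite linearZ /= map_mxZ /= conj_realC adj_ketbra.
Qed.

Lemma ketbra_mulmx u v w : ketbra u v *m w = braket v w *: u.
Proof. by rewrite /ketbra -mulmxA braket_mx mul_mx_scalar. Qed.

Lemma ketbraZ (a : R[i]) u : ketbra (a *: u) (a *: u) = `|a| ^+ 2 *: ketbra u u.
Proof.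
by rewrite /ketbra linearZ /= map_mxZ -scalemxAl -scalemxAr scalerA normCK.
Qed.

Lemma conj_ketbra (A : 'M[R[i]]_d) u :
  A *m ketbra u u *m A^t* = ketbra (A *m u) (A *m u).
Proof. by rewrite /ketbra adj_mxM !mulmxA. Qed.

Lemma ketbra_form u v : (v^t* *m ketbra u u *m v) 0 0 = `|braket u v| ^+ 2.
Proof.
rewrite -mulmxA ketbra_mulmx -scalemxAr mxE -/(braket v u) (braketC u v).
by rewrite normCK.
Qed.

Lemma orthonormal_ketsP k (f : 'I_k -> 'cV[R[i]]_d) :
  orthonormal_kets [seq f i | i : 'I_k] ->
  forall i j, braket (f i) (f j) = (i == j)%:R.
Proof.
case/orthonormalP => Uf Of i j.
(* A list of kets without repetition comes from an injective family, so equality of kets can be read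
   as equality of indices. *)
have /injectiveP injf : injectiveb f by exact: map_uniq Uf.
rewrite braket_dotmx Of ?map_f ?mem_enum //.
by rewrite (inj_eq trmx_inj) (inj_eq injf) eq_sym.
Qed.

Lemma braket_weighted_l k (p : 'I_k -> R) (f : 'I_k -> 'cV[R[i]]_d) u :
  braket (weighted_ket p f) u =
  ((Num.sqrt (\sum_i p i))^-1)%:C * \sum_i (Num.sqrt (p i))%:C * braket (f i) u.
Proof.
rewrite braketZl conj_realC braket_suml; congr (_ * _).
by apply: eq_bigr => i _; rewrite braketZl conj_realC.
Qed.

Lemma braket_weighted_ket k (p : 'I_k -> R) (f : 'I_k -> 'cV[R[i]]_d) :
  (forall i j, braket (f i) (f j) = (i == j)%:R) -> forall i,
  braket (weighted_ket p f) (f i) =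
  ((Num.sqrt (\sum_i p i))^-1 * Num.sqrt (p i))%:C.
Proof.
move=> Of i; rewrite braket_weighted_l [X in _ * X](bigD1 i) //= Of eqxx mulr1.
rewrite [X in _ + X]big1 ?addr0 ?rmorphM // => j ji.
by rewrite Of (negPf ji) mulr0.
Qed.

End Ketbra.

(** * Positivity of a diagonal operator minus a rank-one term *)

Section RankOneUpdate.

Variables (R : rcfType) (d n : nat) (h : 'I_n -> 'cV[R[i]]_d) (p x : 'I_n -> R).
Hypotheses (Oh : forall i j, braket (h i) (h j) = (i == j)%:R).
Hypotheses (x0 : forall j, 0 < x j) (p0 : forall j, 0 < p j).

Let W := \sum_j p j.
Let S := \sum_j p j / x j.

(** Cauchy-Schwarz after splitting each term [sqrt p_j * a_j] as [sqrt x_j * a_j] times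
    [sqrt p_j / sqrt x_j]; the squared norm of the second factor is [S]. *)
Lemma weighted_cauchy (a : 'I_n -> R[i]) :
  `|\sum_j (Num.sqrt (p j))%:C * a j| ^+ 2 <=
  S%:C * \sum_j (x j)%:C * `|a j| ^+ 2.
Proof.
pose u := \row_j ((Num.sqrt (x j))%:C * a j).
pose v := \row_j (Num.sqrt (p j) / Num.sqrt (x j))%:C : 'rV[R[i]]_n.
have [+ _] := CauchySchwarz (@dotmx R[i] n) u v; rewrite /=.
have -> : dotmx u v = \sum_j (Num.sqrt (p j))%:C * a j.
  rewrite dotmxE mxE; apply: eq_bigr => j _; rewrite !mxE /= conj_realC.
  rewrite mulrAC -rmorphM /= mulrCA divff ?mulr1 //.
  by rewrite gt_eqF // sqrtr_gt0.
have -> : dotmx u u = \sum_j (x j)%:C * `|a j| ^+ 2.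
  rewrite dotmxE mxE; apply: eq_bigr => j _; rewrite !mxE /= -normCK.
  rewrite normrM exprMn; congr (_ * _).
  by rewrite ger0_norm ?ler0c ?sqrtr_ge0 // -rmorphXn /= sqr_sqrtr ?ltW.
have -> : dotmx v v = S%:C.
  rewrite dotmxE mxE rmorph_sum; apply: eq_bigr => j _; rewrite !mxE /= -normCK.
  rewrite ger0_norm ?ler0c ?divr_ge0 ?sqrtr_ge0 // -rmorphXn /=.
  by rewrite expr_div_n !sqr_sqrtr ?ltW.
by rewrite mulrC.
Qed.

(** Since [S / W] is the value of <w|X_h^-1|w>, this is the criterion c <w|X_h^-1|w> <= 1 with the
    denominator cleared. *)
Lemma psdmx_rank_one_update (c : R) : (0 < n)%N -> 0 <= c ->
  psdmx (\sum_j (x j)%:C *: ketbra (h j) (h j)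
         - c%:C *: ketbra (weighted_ket p h) (weighted_ket p h)) <->
  c * S <= W.
Proof.
move=> n0 c0.
have W0 : 0 < W.
  rewrite /W (bigD1 (Ordinal n0)) //= ltr_pwDl //.
  by rewrite sumr_ge0 // => j _; rewrite ltW.
have S0 : 0 < S.
  rewrite /S (bigD1 (Ordinal n0)) //= ltr_pwDl ?divr_gt0 //.
  by rewrite sumr_ge0 // => j _; rewrite ltW ?divr_gt0.
(* The form sees [u] only through its amplitudes on the [h j], so kets outside their span need no
   separate treatment. The factor [1 / W] is the squared normalization of the weighted ket. *)
have formE u : (u^t* *m (\sum_j (x j)%:C *: ketbra (h j) (h j)
     - c%:C *: ketbra (weighted_ket p h) (weighted_ket p h)) *m u) 0 0 =
   \sum_j (x j)%:C * `|braket (h j) u| ^+ 2 -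
   (c / W)%:C * `|\sum_j (Num.sqrt (p j))%:C * braket (h j) u| ^+ 2.
  rewrite mulmxBr mulmxBl mulmx_sumr mulmx_suml mxE summxE; congr (_ + _).
    by apply: eq_bigr => j _; rewrite -scalemxAr -scalemxAl mxE ketbra_form.
  rewrite -scalemxAr -scalemxAl mxE mxE ketbra_form braket_weighted_l.
  rewrite normrM exprMn mulrA; congr (- (_ * _)).
  rewrite ger0_norm ?ler0c ?invr_ge0 ?sqrtr_ge0 // -rmorphXn -rmorphM /=.
  by rewrite exprVn sqr_sqrtr ?ltW.
split=> [[_ /(_ (\sum_j (Num.sqrt (p j) / x j)%:C *: h j))]|cSW]; last first.
  split=> [|u].
    rewrite linearB /= map_mxB adj_sum_ketbra linearZ /= map_mxZ.
    by rewrite /= conj_realC adj_ketbra.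
  rewrite formE subr_ge0.
  set q := \sum_j (x j)%:C * _.
  have q0 : 0 <= q.
    by rewrite sumr_ge0 // => j _;
      rewrite mulr_ge0 ?exprn_ge0 ?normr_ge0 // ler0c ltW.
  (* Cauchy-Schwarz bounds the subtracted term by [(c / W) * S * q], and [c * S <= W] makes the
     factor before [q] at most 1. *)
  apply: le_trans (ler_wpM2l _ (weighted_cauchy _)) _.
    by rewrite ler0c divr_ge0 // ltW.
  rewrite -/q mulrA -rmorphM /= ler_piMl //.
  by rewrite -[1]/(1%:C) lecR mulrAC ler_pdivrMr // mul1r.
(* This ket is the equality case of weighted_cauchy. *)
have hu j : braket (h j) (\sum_j (Num.sqrt (p j) / x j)%:C *: h j) =
    (Num.sqrt (p j) / x j)%:C.
  rewrite braket_sumr (bigD1 j) //= braketZr Oh eqxx mulr1 big1 ?addr0 // => k.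
  by move=> kj; rewrite braketZr Oh eq_sym (negPf kj) mulr0.
rewrite formE.
(* At this ket both sums have terms [p j / x j], so the form equals [S - (c / W) * S ^ 2]; dividing
   its nonnegativity by [S > 0] gives the bound. *)
under eq_bigr => j _ do rewrite hu ger0_norm ?ler0c ?divr_ge0 ?sqrtr_ge0 ?ltW //
  -rmorphXn -rmorphM /= expr_div_n sqr_sqrtr ?ltW // mulrCA expr2 invfM
  mulrA -mulrA mulVKf ?gt_eqF //.
under [in X in _ - _ * X]eq_bigr => j _ do
  rewrite hu -rmorphM /= mulrA -expr2 sqr_sqrtr ?ltW //.
have SC0 : 0 <= S%:C :> R[i] by rewrite ler0c ltW.
rewrite -rmorph_sum -/S (ger0_norm SC0) -rmorphXn -rmorphM /=.
by rewrite subr_ge0 lecR expr2 mulrA ger_pMl // mulrAC ler_pdivrMr // mul1r.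
Qed.

End RankOneUpdate.

(** * Image of the [g i] under the blinkered unitary followed by the projection *)

Section BlinkeredAction.

Variables (R : rcfType) (d m n : nat).
Variables (pg : 'I_m -> R) (ph : 'I_n -> R).
Variables (g : 'I_m -> 'cV[R[i]]_d) (h : 'I_n -> 'cV[R[i]]_d).
Variables (vs ws : seq 'cV[R[i]]_d).
Hypothesis (Og : forall i j, braket (g i) (g j) = (i == j)%:R).
Hypothesis (Oh : forall i j, braket (h i) (h j) = (i == j)%:R).
Hypothesis (Ogh : forall i j, braket (g i) (h j) = 0).
Hypothesis (vs_span : {subset vs <= <<[seq g i | i : 'I_m]>>%VS}).
Hypothesis (ws_span : {subset ws <= <<[seq h j | j : 'I_n]>>%VS}).

Let Eh := \sum_j ketbra (h j) (h j).

Lemma weighted_ket_span k (p : 'I_k -> R) (f : 'I_k -> 'cV[R[i]]_d) :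
  weighted_ket p f \in <<[seq f i | i : 'I_k]>>%VS.
Proof.
rewrite memvZ // memv_suml // => j _.
by rewrite memvZ // memv_span // map_f // mem_enum.
Qed.

Lemma proj_h_fix j : Eh *m h j = h j.
Proof.
rewrite mulmx_suml (bigD1 j) //= ketbra_mulmx Oh eqxx scale1r.
rewrite big1 ?addr0 // => k kj.
by rewrite ketbra_mulmx Oh (negPf kj) scale0r.
Qed.

Lemma proj_h_span_g u : u \in <<[seq g i | i : 'I_m]>>%VS -> Eh *m u = 0.
Proof.
move=> ug; rewrite mulmx_suml big1 // => j _.
rewrite ketbra_mulmx (braket_span _ ug) ?scale0r //.
by move=> _ /mapP[i _ ->]; rewrite braketC Ogh conjC0.
Qed.

(** The terms of [U] with a bra in the span of the [h j] annihilate [g i], and those from [vs]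
    produce kets that [Eh] annihilates. What remains is |w> with amplitude <v|g_i>. *)
Lemma proj_h_blinkered i :
  Eh *m (blinkered (weighted_ket pg g) (weighted_ket ph h) vs ws *m g i) =
  ((Num.sqrt (\sum_i pg i))^-1 * Num.sqrt (pg i))%:C *: weighted_ket ph h.
Proof.
have h_orth u : u \in <<[seq h j | j : 'I_n]>>%VS -> braket u (g i) = 0.
  move=> uh; rewrite braketC (braket_span _ uh) ?conjC0 //.
  by move=> _ /mapP[j _ ->].
rewrite /blinkered !mulmxDl !mulmxDr !ketbra_mulmx braket_weighted_ket //.
rewrite (h_orth (weighted_ket ph h)) ?weighted_ket_span // scale0r mulmx0 addr0.
have -> : Eh *m ((\sum_(u <- vs) ketbra u u) *m g i) = 0.
  rewrite [X in Eh *m X]mulmx_suml mulmx_sumr big_seq big1 // => u uvs.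
  by rewrite ketbra_mulmx -scalemxAr proj_h_span_g ?scaler0 ?vs_span.
have -> : (\sum_(u <- ws) ketbra u u) *m g i = 0.
  rewrite mulmx_suml big_seq big1 // => u uws.
  by rewrite ketbra_mulmx h_orth ?scale0r ?ws_span.
rewrite mulmx0 !addr0 -scalemxAr; congr (_ *: _).
rewrite -scalemxAr mulmx_sumr; congr (_ *: _).
by apply: eq_bigr => j _; rewrite -scalemxAr proj_h_fix.
Qed.

End BlinkeredAction.

(** * The criterion for the blinkered unitary, with merges and splits *)

Theorem mainTheorem5 (R : rcfType) (d m n : nat)
    (xg pg : 'I_m -> R) (xh ph : 'I_n -> R)
    (g : 'I_m -> 'cV[R[i]]_d) (h : 'I_n -> 'cV[R[i]]_d)
    (vs ws : seq 'cV[R[i]]_d)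
    (hm : (1 <= m)%N) (hn : (1 <= n)%N)
    (hxg : forall i, 0 <= xg i) (hxg_nz : exists i, xg i != 0)
    (hxh : forall j, 0 < xh j)
    (hpg : forall i, 0 < pg i) (hph : forall j, 0 < ph j)
    (hp : \sum_i pg i = \sum_j ph j)
    (hgh : orthonormal_kets ([seq g i | i : 'I_m] ++ [seq h j | j : 'I_n]))
    (hvs : orthonormal_basis_of <<[seq g i | i : 'I_m]>>%VS
             (weighted_ket pg g :: vs))
    (hws : orthonormal_basis_of <<[seq h j | j : 'I_n]>>%VS
             (weighted_ket ph h :: ws)) :
  let U := blinkered (weighted_ket pg g) (weighted_ket ph h) vs ws in
  let Eh := \sum_j ketbra (h j) (h j) in
  let constraint :=
    psdmx (\sum_j (xh j)%:C *: ketbra (h j) (h j)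
           - \sum_i (xg i)%:C *:
               (Eh *m U *m ketbra (g i) (g i) *m U^t* *m Eh)) in
  [/\ constraint <-> 1 / wavg pg xg >= wavg ph (fun j => 1 / xh j),
      n = 1%N -> (forall j, xh j >= wavg pg xg) -> constraint &
      m = 1%N -> (forall i, 1 / xg i >= wavg ph (fun j => 1 / xh j)) ->
        constraint].
Proof.
move=> U Eh constraint.
move: hgh; rewrite /orthonormal_kets map_cat orthonormal_cat => /and3P[Ogs Ohs].
move=> /orthogonalP Oghs.
have Og := orthonormal_ketsP Ogs.
have Oh := orthonormal_ketsP Ohs.
have Ogh i j : braket (g i) (h j) = 0.
  rewrite braketC braket_dotmx Oghs ?conjC0 //.
    by rewrite !map_f ?mem_enum.
  by rewrite !map_f ?mem_enum.
have basis_sub V b (s : seq 'cV[R[i]]_d) :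
    orthonormal_basis_of V (b :: s) -> {subset s <= V}.
  by move=> /andP[_ bV] u us; rewrite (basis_mem bV) // inE us orbT.
have W0 : 0 < \sum_i pg i.
  rewrite (bigD1 (Ordinal hm)) //= ltr_pwDl //.
  by rewrite sumr_ge0 // => i _; rewrite ltW.
(* The nonzero [xg i] makes the average strictly positive, so its reciprocal can be cleared from the
   inequality later. *)
have c0 : 0 < wavg pg xg.
  have [i xi0] := hxg_nz.
  rewrite divr_gt0 // (bigD1 i) //= ltr_pwDl //.
    by rewrite mulr_gt0 // lt0r xi0 hxg.
  by rewrite sumr_ge0 // => j _; rewrite mulr_ge0 // ltW.
have EhH : Eh^t* = Eh.
  rewrite linear_sum /= map_mx_sum; apply: eq_bigr => j _.
  by rewrite adj_ketbra.
have UgE : \sum_i (xg i)%:C *: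
      (Eh *m U *m ketbra (g i) (g i) *m U^t* *m Eh) =
    (wavg pg xg)%:C *: ketbra (weighted_ket ph h) (weighted_ket ph h).
  rewrite /wavg mulr_suml rmorph_sum scaler_suml; apply: eq_bigr => i _.
  (* Writing the right-hand [Eh] as its own adjoint turns each summand into a conjugation of
     |g_i><g_i| by [Eh *m U], hence into the ketbra of the image of [g i]. *)
  rewrite -{2}EhH -mulmxA -adj_mxM conj_ketbra -mulmxA.
  rewrite (proj_h_blinkered _ _ Og Oh Ogh (basis_sub _ _ _ hvs)
            (basis_sub _ _ _ hws)) ketbraZ scalerA; congr (_ *: _).
  (* The squared amplitude is [pg i] over the total weight, so the coefficients of |w><w| add up to
     the weighted average of [xg]. *)
  rewrite ger0_norm ?ler0c ?mulr_ge0 ?invr_ge0 ?sqrtr_ge0 //.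
  rewrite -rmorphXn -rmorphM /=.
  rewrite exprMn exprVn !sqr_sqrtr ?ltW //.
  by rewrite mulrCA mulrC [pg i * _]mulrC.
have main : constraint <-> wavg ph (fun j => 1 / xh j) <= 1 / wavg pg xg.
  rewrite /constraint UgE psdmx_rank_one_update //; last exact: ltW.
  have -> : wavg ph (fun j => 1 / xh j) = (\sum_j ph j / xh j) / \sum_j ph j.
    by rewrite /wavg; under eq_bigr do rewrite div1r.
  (* Equality of the total weights puts the denominator in the form whose positivity is [W0]; both
     denominators are then cleared. *)
  rewrite -hp; move: (wavg pg xg) c0 => c c0.
  by rewrite ler_pdivlMr // mulrAC ler_pdivrMr // mul1r mulrC.
split=> // [n1 xhc | m1 xgc]; apply/main.
(* An average over a single point is its value there: a merge compares two reciprocals of positive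
   numbers, and a split is the criterion itself. *)
- subst n; rewrite /wavg !big_ord1 mulrAC divff ?gt_eqF // mul1r.
  by rewrite !div1r lef_pV2 ?posrE.
- subst m; rewrite [wavg pg xg]/wavg !big_ord1.
  by rewrite mulrAC divff ?gt_eqF // [1 * xg _]mul1r.
Qed.
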